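(* Let $\mathcal{I}$ be a T-maximal ideal on $\mathbb{N}$. Then for any $A,B\subseteq\mathbb{N}$ with $A,B\notin\mathcal{I}$ there is $k\in\mathbb{Z}$ with $(A+k)\cap B\notin\mathcal{I}$. In particular, there is no $\mathcal{I}$-TAD family of cardinality $\mathfrak{c}$.
   Context: For $A\subseteq\mathbb{N}$ and $k\in\mathbb{Z}$, $A+k$ denotes $\{a+k:a\in A\}\cap\mathbb{N}$. An ideal on $\mathbb{N}$ is a family $\mathcal{I}\subseteq\mathcal{P}(\mathbb{N})$ closed under finite unions and subsets, containing all finite subsets of $\mathbb{N}$, with $\mathbb{N}\notin\mathcal{I}$; it is translation invariant if $A+k\in\mathcal{I}$ for all $A\in\mathcal{I}$, $k\in\mathbb{Z}$. A translation invariant ideal $\mathcal{I}$ is T-maximal if for every translation invariant ideal $\mathcal{J}$, $\mathcal{I}\subseteq\mathcal{J}$ implies $\mathcal{I}=\mathcal{J}$. $\mathcal{I}^+=\{A\subseteq\mathbb{N}:A\notin\mathcal{I}\}$. A family $\mathcal{A}\subseteq\mathcal{P}(\mathbb{N})$ is an $\mathcal{I}$-TAD family if $\mathcal{A}\subseteq\mathcal{I}^+$ and $A\cap(B+k)\in\mathcal{I}$ for all distinct $A,B\in\mathcal{A}$ and all $k\in\mathbb{Z}$. $\mathfrak{c}$ is the cardinality of the continuum. *)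

(* Defs.v *)
From mathcomp Require Import all_boot all_order all_algebra.
From mathcomp Require Import mathcomp_extra boolp classical_sets cardinality reals.

Set Implicit Arguments.
Unset Strict Implicit.
Unset Printing Implicit Defensive.

Local Open Scope classical_set_scope.

(* A + k for k in Z, intersected with N; the sum is taken in [int], so that
   negative shifts drop elements instead of truncating them to 0. *)
Definition shift (A : set nat) (k : int) : set nat :=
  [set n | exists2 a, A a & (n%:Z = a%:Z + k)%R].

Record ideal (I : set (set nat)) : Prop := Ideal {
  ideal_setU : forall A B, I A -> I B -> I (A `|` B);
  ideal_sub : forall A B, A `<=` B -> I B -> I A;
  ideal_finite : forall A, finite_set A -> I A;
  ideal_proper : ~ I setT }.

Definition translation_invariant (I : set (set nat)) : Prop :=
  forall A k, I A -> I (shift A k).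

Record T_maximal (I : set (set nat)) : Prop := TMaximal {
  T_maximal_ideal : ideal I;
  T_maximal_inv : translation_invariant I;
  T_maximal_max : forall J : set (set nat),
    ideal J -> translation_invariant J -> I `<=` J -> I = J }.

Definition ideal_pos (I : set (set nat)) : set (set nat) := [set A | ~ I A].

Definition TAD (I F : set (set nat)) : Prop :=
  F `<=` ideal_pos I /\
  forall A B, F A -> F B -> A <> B -> forall k : int, I (A `&` shift B k).

(* Main.v *)
Require Import Defs.
From mathcomp Require Import all_boot all_order all_algebra.
From mathcomp Require Import mathcomp_extra boolp classical_sets cardinality reals.

Set Implicit Arguments.
Unset Strict Implicit.
Unset Printing Implicit Defensive.

Import GRing.Theory.

Local Open Scope classical_set_scope.
Local Open Scope card_scope.

(** For [B] outside [I], the sets all of whose translates meet [B] in a member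
    of [I] form a translation invariant ideal containing [I]; by T-maximality
    this ideal is [I], so no [A] outside [I] belongs to it. *)

Lemma shift0 (A : set nat) : shift A 0%R = A.
Proof.
apply/seteqP; split=> [n [a Aa]|n An]; last by exists n; rewrite ?addr0.
by rewrite addr0 => -[->].
Qed.

(** Equality can fail: when [k] is negative, the inner shift drops elements that a positive [l]
    would have brought back into the naturals. Ideals are closed under subsets, so the inclusion
    suffices for invariance. *)
Lemma shift_shift_sub (A : set nat) (k l : int) :
  shift (shift A k) l `<=` shift A (k + l)%R.
Proof. by move=> n [m [a Aa ma] nm]; exists a => //; rewrite nm ma addrA. Qed.

Lemma shift_sub (A B : set nat) (k : int) :
  A `<=` B -> shift A k `<=` shift B k.
Proof. by move=> AB n [a /AB Ba nE]; exists a. Qed.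

Lemma shift_setU (A B : set nat) (k : int) :
  shift (A `|` B) k `<=` shift A k `|` shift B k.
Proof. by move=> n [a [Aa|Ba] nE]; [left|right]; exists a. Qed.

Definition trace_ideal (I : set (set nat)) (B : set nat) : set (set nat) :=
  [set X | forall k : int, I (shift X k `&` B)].

Section TraceIdeal.
Variables (I : set (set nat)) (B : set nat).
Hypotheses (idI : ideal I) (invI : translation_invariant I).

Lemma sub_trace_ideal : I `<=` trace_ideal I B.
Proof.
by move=> X IX k; apply: (ideal_sub idI (@subIsetl _ _ _)); apply: invI.
Qed.

Lemma trace_ideal_invariant : translation_invariant (trace_ideal I B).
Proof.
move=> X k JX l; apply: (ideal_sub idI) (JX (k + l)%R).
by apply: setSI; apply: shift_shift_sub.
Qed.

Lemma trace_ideal_ideal : ~ I B -> ideal (trace_ideal I B).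
Proof.
move=> nIB; split.
- move=> X Y JX JY k; apply: (ideal_sub idI) (ideal_setU idI (JX k) (JY k)).
  by rewrite -setIUl; apply: setSI; apply: shift_setU.
- move=> X Y XY JY k; apply: (ideal_sub idI) (JY k).
  by apply: setSI; apply: shift_sub.
- by move=> X /(ideal_finite idI); apply: sub_trace_ideal.
(* Properness comes from the shift by 0, at which the trace of the whole set on [B] is [B] itself,
   outside [I]. *)
- by move=> /(_ 0%R); rewrite shift0 setTI.
Qed.

End TraceIdeal.

Lemma T_maximal_shift_meet (I : set (set nat)) (A B : set nat) :
  T_maximal I -> ~ I A -> ~ I B -> exists k : int, ~ I (shift A k `&` B).
Proof.
move=> [idI invI maxI] nIA nIB; apply/existsNP => JA; apply: nIA.
(* Once [I] is replaced by the trace ideal, the goal [I A] unfolds to [JA]. *)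
rewrite (maxI (trace_ideal I B)) //.
- exact: trace_ideal_ideal.
- exact: trace_ideal_invariant.
- exact: sub_trace_ideal.
Qed.

Lemma T_maximal_TAD_subsingleton (I F : set (set nat)) :
  T_maximal I -> TAD I F -> is_subset1 F.
Proof.
move=> hI [Fpos FI] A B FA FB; apply: contrapT => AB.
(* The shifted set is [B], to match the intersections in [TAD] up to commutativity. *)
have [k] := T_maximal_shift_meet hI (Fpos _ FB) (Fpos _ FA).
by rewrite setIC; apply; apply: FI.
Qed.

Theorem theorem3p10 (I : set (set nat)) (hI : T_maximal I) :
  (forall A B : set nat, ~ I A -> ~ I B ->
     exists k : int, ~ I (shift A k `&` B)) /\
  (forall R : realType,
     ~ exists F : set (set nat), TAD I F /\ F #= [set: R]).
Proof.
split=> [A B|R [F [FTAD]]]; first exact: T_maximal_shift_meet.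
(* A bijection from [R] onto [F] would map 0 and 1 to the same member of [F], against
   injectivity. *)
rewrite card_eq_sym => /card_set_bijP[f [fF finj _]].
have /finj : f 0%R = f 1%R.
  by apply: (T_maximal_TAD_subsingleton hI FTAD); apply: fF.
by rewrite !in_setT => /(_ isT isT)/eqP; rewrite eq_sym oner_eq0.
Qed.
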